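(* Let $\Lambda\subseteq\mathbb{R}^d$ be any Meyer set. If $(\mathbb{R}^d,\mathbb{R}^m,\mathcal{L})$ and $(\mathbb{R}^d,\mathbb{R}^n,\mathcal{L}')$ are two different cut and project schemes, $W\subseteq\mathbb{R}^m$, $W'\subseteq\mathbb{R}^n$ are precompact windows with non-empty interior, and $F,F'\subseteq\mathbb{R}^d$ are finite sets such that $$\Lambda\subseteq\curlywedge(W)+F,\qquad \Lambda\subseteq\curlywedge'(W')+F',$$ where $\curlywedge(W)$ is formed in $(\mathbb{R}^d,\mathbb{R}^m,\mathcal{L})$ and $\curlywedge'(W')$ in $(\mathbb{R}^d,\mathbb{R}^n,\mathcal{L}')$, then $m=n$.
   Context: Here $d\ge 1$ and $m,n\ge 0$ are integers, and $B_R(x)$ denotes the ball of radius $R$ centred at $x$. A set $\Lambda\subseteq\mathbb{R}^d$ is relatively dense if there is $R>0$ such that every ball $B_R(x)$, $x\in\mathbb{R}^d$, contains a point of $\Lambda$; it is uniformly discrete if there is $r>0$ such that every ball $B_r(x)$ contains at most one point of $\Lambda$. A Meyer set is a relatively dense set $\Lambda\subseteq\mathbb{R}^d$ such that $\Lambda-\Lambda$ is uniformly discrete. A (fully Euclidean) cut and project scheme $(\mathbb{R}^d,\mathbb{R}^m,\mathcal{L})$ consists of $\mathbb{R}^d$, $\mathbb{R}^m$ and a lattice (discrete co-compact subgroup) $\mathcal{L}\subset\mathbb{R}^d\times\mathbb{R}^m$ such that the canonical projection to $\mathbb{R}^d$ is injective on $\mathcal{L}$ and the image of $\mathcal{L}$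 under the canonical projection to $\mathbb{R}^m$ is dense in $\mathbb{R}^m$. For $W\subseteq\mathbb{R}^m$, the set formed in this scheme is $\curlywedge(W):=\{x\in\mathbb{R}^d : \exists\, y\in W \text{ with } (x,y)\in\mathcal{L}\}$. *)

(* Defs.v *)
From HB Require Import structures.
From mathcomp Require Import all_boot all_order all_algebra.
From mathcomp Require Import all_classical all_reals all_analysis.

Set Implicit Arguments.
Unset Strict Implicit.
Unset Printing Implicit Defensive.

Import Order.TTheory GRing.Theory Num.Theory.
Import numFieldNormedType.Exports.

Local Open Scope classical_set_scope.
Local Open Scope ring_scope.

(* The norm and [ball] that the library puts on ['rV[R]_d] are those of the
   sup norm, hence an explicit Euclidean ball; the topology is the same. *)
Definition euclid_ball (R : realType) (d : nat) (x : 'rV[R]_d) (r : R) :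
    set 'rV[R]_d :=
  [set y | Num.sqrt (\sum_(i < d) (y 0 i - x 0 i) ^+ 2) < r].

Definition relatively_dense (R : realType) (d : nat) (A : set 'rV[R]_d) :=
  exists2 r : R, 0 < r & forall x, euclid_ball x r `&` A !=set0.

Definition uniformly_discrete (R : realType) (d : nat) (A : set 'rV[R]_d) :=
  exists2 r : R, 0 < r & forall x, is_subset1 (euclid_ball x r `&` A).

Definition set_add (V : zmodType) (A B : set V) : set V :=
  [set a + b | a in A & b in B].

Definition set_sub (V : zmodType) (A B : set V) : set V :=
  [set a - b | a in A & b in B].

Definition meyer_set (R : realType) (d : nat) (A : set 'rV[R]_d) :=
  relatively_dense A /\ uniformly_discrete (set_sub A A).

Definition discrete_subset (T : topologicalType) (A : set T) :=
  A `<=` isolated A.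

(* The type [zmodClosed V] already bundles that [L] is a subgroup of [V]. *)
Definition cocompact (V : topologicalZmodType) (L : zmodClosed V) :=
  compact [set: quotient_topology (Quotient.quot L)].

Definition lattice (V : topologicalZmodType) (L : zmodClosed V) :=
  discrete_subset [set` L] /\ cocompact L.

Definition cut_project_scheme (R : realType) (d m : nat)
    (L : zmodClosed ('rV[R]_d * 'rV[R]_m)%type) :=
  [/\ lattice L, {in L &, injective fst} & dense (snd @` [set` L])].

Definition cut_project_set (R : realType) (d m : nat)
    (L : zmodClosed ('rV[R]_d * 'rV[R]_m)%type) (W : set 'rV[R]_m) :
    set 'rV[R]_d :=
  [set x | exists2 y, W y & (x, y) \in L].

(* Main.v *)
Require Import Defs.
From HB Require Import structures.
From mathcomp Require Import all_boot all_order all_algebra.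
From mathcomp Require Import all_classical all_reals all_analysis.
From mathcomp Require Import ring lra.

Set Implicit Arguments.
Unset Strict Implicit.
Unset Printing Implicit Defensive.

Import Order.TTheory GRing.Theory Num.Theory.
Import numFieldNormedType.Exports.

Local Open Scope classical_set_scope.
Local Open Scope ring_scope.

(** The number [d + m] can be read off from [Lambda], because it is the rank of
    an abelian group attached to [Lambda] and to both schemes at once.

    Partition [Lambda] according to the pair [(f, f')] of translations used to
    cover a point, and subtract from each part one of its own points.  The
    resulting set [D] is still relatively dense, lies in the projections of both
    lattices, and the internal coordinates of its lifts to [L] and to [L'] stay
    bounded ([common_lifts]).

    The lifts of [D] to [L] span R^d x R^m over the reals ([lifts_total]).
    Suppose that a linear form [(u, v)] kills them.  Boundedness of the internal
    coordinates makes [u] bounded on R^d, hence zero.  Subtracting from a point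
    of [L] a lift of [D] close to it in R^d then does not change the value of
    [v], so on the points of [L] with internal coordinate in the unit ball [v]
    takes its values in the finite set of values at the points of [L] in a
    fixed box.  These internal coordinates are dense in the ball, so [v] is zero.

    Hence [d + m] lifts of points of [D] are linearly independent.  The same
    points of [D] also lift to the discrete group [L'] in R^(d + n).  If
    [n < m], a pigeonhole argument yields a nontrivial integer relation between
    these [d + m] lifts ([combination_eq]); it projects to a relation in R^d,
    which injectivity of the projection of [L] carries back to the independent
    lifts, a contradiction.  So [m <= n] ([internal_dim_le]), and the situation
    is symmetric. *)

(** * Pigeonhole in boxes *)

Lemma not_injective_card (T T' : finType) (f : T -> T') :
  (#|T'| < #|T|)%N -> exists s t, s <> t /\ f s = f t.
Proof.
move=> lt_card; have: ~ injective f.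
  by move=> /leq_card; rewrite leqNgt lt_card.
move=> /existsNP[s /existsNP[t /not_implyP[fst_eq neq]]].
by exists s, t.
Qed.

(** Cutting the cube [[-b delta, b delta]^I] into cells of side [delta] leaves
    at most [(2 b + 1) ^ #|I|] cells, and two points in one cell are closer than
    [delta] in every coordinate. *)
Lemma packing (R : realType) (T I : finType) (f : T -> I -> R) (delta : R)
    (b : nat) :
  0 < delta -> (forall t i, `|f t i| <= b%:R * delta) ->
  ((b.*2.+1) ^ #|I| < #|T|)%N ->
  exists s t, s <> t /\ forall i, `|f s i - f t i| < delta.
Proof.
move=> delta_gt0 f_le card_lt.
(* The shift by [b] makes the rescaled coordinates nonnegative. *)
pose v t i := f t i / delta + b%:R.
have vbnd t i : 0 <= v t i <= b.*2%:R.
  have : `|f t i / delta| <= b%:R.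
    by rewrite normrM normfV (gtr0_norm delta_gt0) ler_pdivrMr.
  rewrite ler_norml /v -addnn natrD lerD2r => /andP[h1 ->].
  by rewrite -lerBlDr sub0r h1.
have v_trunc t i : (Num.truncn (v t i))%:R <= v t i < (Num.truncn (v t i)).+1%:R.
  by apply: truncn_itv; case/andP: (vbnd t i).
have trunc_lt t i : (Num.truncn (v t i) < b.*2.+1)%N.
  rewrite ltnS -(ler_nat R); apply: le_trans (proj2 (andP (vbnd t i))).
  by case/andP: (v_trunc t i).
pose g t := [ffun i => Ordinal (trunc_lt t i)].
have [|s [t [st gst]]] := @not_injective_card T {ffun I -> 'I_(b.*2.+1)} g.
  by rewrite card_ffun card_ord.
exists s, t; split=> // i.
have /(congr1 val) /= eq_tr : g s i = g t i by rewrite gst.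
rewrite !ffunE /= in eq_tr.
have : `|v s i - v t i| < 1.
  move: (v_trunc s i) (v_trunc t i); rewrite eq_tr -natr1.
  move=> /andP[s1 s2] /andP[t1 t2].
  by rewrite ltr_norml; lra.
have -> : v s i - v t i = (f s i - f t i) / delta by rewrite /v; ring.
rewrite normrM normfV (gtr0_norm delta_gt0).
by rewrite ltr_pdivrMr // mul1r.
Qed.

Lemma coord_le_norm (R : realType) (n : nat) (x : 'rV[R]_n) i :
  `|x 0 i| <= `|x|.
Proof.
by rewrite {2}/Num.norm /= mx_normrE; exact: (le_bigmax _ _ (0, i)).
Qed.

Lemma norm_lt_coord (R : realType) (n : nat) (x : 'rV[R]_n) (e : R) :
  0 < e -> (forall i, `|x 0 i| < e) -> `|x| < e.
Proof.
move=> e0 h; rewrite /Num.norm /= mx_normrE; apply: bigmax_lt => // -[i j] _ /=.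
by rewrite ord1.
Qed.

Lemma packing_pair (R : realType) (T : finType) (d n : nat)
    (f : T -> ('rV[R]_d * 'rV[R]_n)%type) (delta : R) (b : nat) :
  0 < delta -> (forall t, `|f t| <= b%:R * delta) ->
  ((b.*2.+1) ^ (d + n) < #|T|)%N ->
  exists s t, s <> t /\ `|f s - f t| < delta.
Proof.
move=> delta0 f_le lt_card.
pose c t (i : 'I_d + 'I_n) :=
  match i with inl i => (f t).1 0 i | inr i => (f t).2 0 i end.
have [||s [t [st cst]]] := @packing R T _ c delta b delta0.
- move=> t i; apply: le_trans (f_le t).
  by rewrite prod_normE le_max; case: i => i; rewrite /c coord_le_norm ?orbT.
- by rewrite card_sum !card_ord.
exists s, t; split=> //; rewrite prod_normE gt_max; apply/andP; split.
- by apply: norm_lt_coord => // i; have := cst (inl i); rewrite /= !mxE.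
- by apply: norm_lt_coord => // i; have := cst (inr i); rewrite /= !mxE.
Qed.

(** * Discrete subgroups *)

Lemma discrete_separated (R : realType) (V : normedModType R)
    (L : zmodClosed V) :
  discrete_subset [set` L] ->
  exists2 delta : R, 0 < delta & forall x, x \in L -> `|x| < delta -> x = 0.
Proof.
move=> /(_ 0 (rpred0 L))[_ [U /nbhs_ballP[e /= e0 eU] UL]].
exists e => // x xL xe.
suff : (U `&` [set` L]) x by rewrite UL.
split=> //; apply: eU.
by rewrite -ball_normE /= sub0r normrN.
Qed.

(** The pigeonhole inequality: multiplying the size of a box in dimension [e] by
    [k] creates of order [k ^ e] cells, which cannot keep up with the [k ^ N]
    integer vectors with entries below [k]. *)
Lemma box_count_lt (b e N k : nat) :
  ((b.*2.+1) ^ e < k)%N -> (e < N)%N -> (((k * b).*2.+1) ^ e < k ^ N)%N.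
Proof.
move=> lt_k ltN; have k0 : (0 < k)%N by apply: leq_trans lt_k.
apply: (@leq_ltn_trans ((k * b.*2.+1) ^ e)).
  have [->//|e0] := posnP e; rewrite leq_exp2r //.
  by rewrite mulnS -doubleMr addnC -addn1 leq_add2l.
rewrite expnMn; apply: (@leq_trans (k ^ e.+1)); last by rewrite leq_pexp2l.
by rewrite expnS mulnC ltn_pmul2r ?expn_gt0 ?k0.
Qed.

(** More than [d + n] elements of a discrete subgroup of R^(d + n) satisfy a
    nontrivial integer relation, written as the coincidence of two combinations
    with natural coefficients: the combinations with coefficients below [k] lie
    in a box of size [O(k)], so for large [k] two of them are closer than the
    separation of the group. *)
Lemma combination_eq (R : realType) (d n N : nat)
    (L : zmodClosed ('rV[R]_d * 'rV[R]_n)%type)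
    (h : 'I_N -> ('rV[R]_d * 'rV[R]_n)%type) :
  discrete_subset [set` L] -> (forall i, h i \in L) -> (d + n < N)%N ->
  exists p q : 'I_N -> nat,
    ~ p =1 q /\ \sum_i h i *+ p i = \sum_i h i *+ q i.
Proof.
move=> /discrete_separated[delta delta0 Ldelta] hL ltN.
pose b := (Num.truncn ((\sum_i `|h i|) / delta)).+1.
have hb : \sum_i `|h i| <= b%:R * delta.
  by rewrite -ler_pdivrMr // ltW // truncnS_gt.
have [k ltk] : exists k, ((b.*2.+1) ^ (d + n) < k)%N by eexists.
pose f (p : {ffun 'I_N -> 'I_k}) := \sum_i h i *+ p i.
have [||p [q [pq fpq]]] := @packing_pair R _ _ _ f delta (k * b)%N delta0.
- move=> p; apply: le_trans (ler_norm_sum _ _ _) _.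
  rewrite natrM -mulrA mulr_natl.
  apply: le_trans (_ : (\sum_i `|h i|) *+ k <= _).
    2: by rewrite lerMn2r hb orbT.
  rewrite -sumrMnl; apply: ler_sum => i _.
  rewrite normrMn; apply: ler_wpMn2l => //; exact: ltnW.
- rewrite card_ffun !card_ord.
  exact: box_count_lt.
exists (fun i => val (p i)), (fun i => val (q i)); split.
  by move=> epq; apply/pq/ffunP => i; apply/val_inj/epq.
apply/eqP; rewrite -subr_eq0; apply/eqP; apply: Ldelta => //.
by apply: rpredB; apply: rpred_sum => i _; apply: rpredMn.
Qed.

(** * Linear forms and lifts *)

Lemma linear_form_le (R : realType) (n : nat) (u : 'cV[R]_n) :
  exists2 C : R, 0 <= C & forall x : 'rV_n, `|(x *m u) 0 0| <= C * `|x|.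
Proof.
exists (\sum_i `|u i 0|); first by apply: sumr_ge0.
move=> x; rewrite mxE mulr_suml; apply: le_trans (ler_norm_sum _ _ _) _.
apply: ler_sum => i _; rewrite normrM mulrC ler_wpM2l //.
exact: coord_le_norm.
Qed.

Lemma linear_form_bounded_eq0 (R : realType) (n : nat) (u : 'cV[R]_n) (C : R) :
  (forall x : 'rV_n, `|(x *m u) 0 0| <= C) -> u = 0.
Proof.
move=> bnd; apply/matrixP => i j; rewrite ord1 mxE.
apply/eqP/negPn/negP => ui0.
have := bnd ((C + 1) / u i 0 *: delta_mx 0 i).
rewrite -scalemxAl -rowE !mxE divfK // => /(le_trans (ler_norm _)); lra.
Qed.

Lemma linear_form_open (R : realType) (n : nat) (v : 'cV[R]_n) (a b : R) :
  open [set y : 'rV[R]_n | a < (y *m v) 0 0 < b].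
Proof.
have cont : continuous (fun y : 'rV[R]_n => (y *m v) 0 0).
  have -> : (fun y : 'rV[R]_n => (y *m v) 0 0) =
      (fun y => \sum_(i < n) y 0 i * v i 0).
    by apply/funext => y; rewrite mxE.
  apply: continuous_big; first exact: add_continuous.
  move=> i _ y; apply: continuousM; last exact: cst_continuous.
  exact: (@coord_continuous R 1 n 0 i).
have -> : [set y : 'rV[R]_n | a < (y *m v) 0 0 < b] =
    (fun y : 'rV[R]_n => (y *m v) 0 0) @^-1` [set` `]a, b[].
  by apply/seteqP; split=> y /=; rewrite in_itv.
apply: open_comp; last exact: interval_open.
by move=> y _; exact: cont.
Qed.

(** A set [S] of points of [L] with bounded internal coordinates and relatively
    dense projection to R^d is total: no nonzero linear form [(u, v)] vanishes on it. *)
Lemma lifts_total (R : realType) (d m : nat)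
    (L : zmodClosed ('rV[R]_d * 'rV[R]_m)%type)
    (S : set ('rV[R]_d * 'rV[R]_m)%type) (r B : R) (u : 'cV[R]_d)
    (v : 'cV[R]_m) :
  discrete_subset [set` L] -> dense (snd @` [set` L]) ->
  S `<=` [set` L] -> (forall s, S s -> `|s.2| <= B) ->
  (forall x, exists2 s, S s & `|x - s.1| <= r) ->
  (forall s, S s -> (s.1 *m u + s.2 *m v) 0 0 = 0) -> u = 0 /\ v = 0.
Proof.
move=> /discrete_separated[delta delta0 Ldelta] dL SL SB Sr Suv.
have u0 : u = 0.
  have [C C0 hC] := linear_form_le u; have [C' C'0 hC'] := linear_form_le v.
  apply: (@linear_form_bounded_eq0 _ _ _ (C * r + C' * B)) => x.
  have [s Ss xs] := Sr x.
  have -> : (x *m u) 0 0 = ((x - s.1) *m u) 0 0 - (s.2 *m v) 0 0.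
    by have := Suv s Ss; rewrite mulmxBl !mxE; lra.
  apply: le_trans (ler_normB _ _) _; apply: lerD.
    by apply: le_trans (hC _) _; rewrite ler_wpM2l.
  by apply: le_trans (hC' _) _; rewrite ler_wpM2l // SB.
split=> //; apply/eqP/negPn/negP => v0.
(* [v] is positive at [v^T / c], a point of the open unit ball; [sigma] is its
   value there. *)
pose c := `|v^T| + 1; have c0 : 0 < c by rewrite ltr_wpDl.
pose sigma := (c^-1 *: v^T *m v) 0 0.
have sigma0 : 0 < sigma.
  rewrite /sigma -scalemxAl mxE mulr_gt0 ?invr_gt0 // lt_def.
  have sq i : v^T 0 i * v i 0 = v i 0 ^+ 2 by rewrite mxE expr2.
  rewrite mxE sumr_ge0 ?andbT; last by move=> i _; rewrite sq sqr_ge0.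
  apply: contra v0 => /eqP /psumr_eq0P h; apply/eqP/matrixP => i j.
  rewrite ord1 mxE; apply/eqP; rewrite -sqrf_eq0 -sq; apply/eqP/h => // k _.
  by rewrite sq sqr_ge0.
pose b := (Num.truncn ((r + B + 1) / delta)).+1.
have hb : r + B + 1 <= b%:R * delta.
  by rewrite -ler_pdivrMr // ltW // truncnS_gt.
have [M ltM] : exists M, ((b.*2.+1) ^ (d + m) < M)%N by eexists.
have M0 : 0 < M%:R :> R by rewrite ltr0n; exact: leq_ltn_trans ltM.
(* By density, [L] contains [M] points in the slab [`|l.2| < 1], separated by
   their values under [v], with [M] above the number of cells of the box. *)
have /choice[g hg] : forall k : 'I_M, exists l, [/\ l \in L, `|l.2| < 1 &
    k%:R < (l.2 *m v) 0 0 / sigma * M%:R < k.+1%:R].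
  move=> k.
  pose U := [set y : 'rV[R]_m | `|y| < 1] `&`
    [set y | k%:R / M%:R * sigma < (y *m v) 0 0 < k.+1%:R / M%:R * sigma].
  have [||y [[y1 yv] [l lL ly]]] := dL U.
  - have [t [t0 t1 tE]] : exists t : R,
        [/\ 0 <= t, t <= 1 & t = (k%:R + 2^-1) / M%:R].
      exists ((k%:R + 2^-1) / M%:R); split=> //.
      rewrite ler_pdivrMr // mul1r; have := ltn_ord k.
      rewrite -(ler_nat R) -natr1; lra.
    exists (t *: (c^-1 *: v^T)); split=> /=.
      rewrite 2!normrZ (ger0_norm t0) gtr0_norm ?invr_gt0 //.
      apply: le_lt_trans (ler_piMl _ t1) _.
        by rewrite mulr_ge0 // invr_ge0 ltW.
      by rewrite mulrC ltr_pdivrMr // mul1r /c ltrDl.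
    rewrite -(scalemxAl t) mxE -/sigma !ltr_pM2r // tE !ltr_pM2r ?invr_gt0 //.
    rewrite -[k.+1%:R]natr1; lra.
  - apply: openI; last exact: linear_form_open.
    have -> : [set y : 'rV[R]_m | `|y| < 1] = ball 0 1.
      by rewrite -ball_normE; apply/seteqP; split=> y /=; rewrite sub0r normrN.
    exact: ball_open.
  exists l; rewrite ly; split=> //; move: yv => /=.
  rewrite -(ltr_pdivrMr _ _ M0) -(ltr_pdivlMr _ _ M0).
  by rewrite (ltr_pdivlMr _ _ sigma0) (ltr_pdivrMr _ _ sigma0).
(* Translating by elements of [S] brings these points into one box of R^(d + m)
   and preserves their values under [v], because [u = 0]. *)
have /choice[s hs] : forall k : 'I_M, exists s, S s /\ `|(g k).1 - s.1| <= r.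
  by move=> k; have [s Ss hs] := Sr (g k).1; exists s.
have [||i [j [ij fij]]] :=
    @packing_pair R _ _ _ (fun k => g k - s k) delta b delta0.
- move=> k; apply: le_trans hb.
  have [_ g1 _] := hg k; have [/SB sB sr] := hs k.
  have B0 : 0 <= B by apply: le_trans sB.
  have r0 : 0 <= r by apply: le_trans sr.
  rewrite prod_normE ge_max; apply/andP; split => /=; first by lra.
  apply: le_trans (ler_normB _ _) _; lra.
- by rewrite card_ord.
have eq_f : g i - s i = g j - s j.
  apply/eqP; rewrite -subr_eq0; apply/eqP; apply: Ldelta => //.
  by rewrite !rpredB //; [case: (hg i)|apply: SL; case: (hs i)
                         |case: (hg j)|apply: SL; case: (hs j)].
have val_f k : ((g k - s k).2 *m v) 0 0 = ((g k).2 *m v) 0 0.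
  have [/Suv + _] := hs k; rewrite u0 mulmx0 add0r => sv.
  by rewrite /= mulmxBl mxE [X in _ + X]mxE sv subr0.
have [_ _ hi] := hg i; have [_ _ hj] := hg j.
move: hi; rewrite -val_f eq_f val_f => hi.
move/andP: hi => [hi1 hi2]; move/andP: hj => [hj1 hj2].
apply: ij; apply: val_inj; apply/eqP; rewrite eqn_leq.
apply/andP; split; rewrite -ltnS -(ltr_nat R).
- exact: lt_trans hi1 hj2.
- exact: lt_trans hj1 hi2.
Qed.

(** A set of vectors on which no nonzero linear form vanishes contains a basis;
    the vectors are picked greedily, each outside the kernel of a linear form
    that kills the earlier ones. *)
Lemma spanning_row_free (F : fieldType) (N : nat) (S : set 'rV[F]_N) :
  (forall phi : 'cV[F]_N, (forall s, S s -> s *m phi = 0) -> phi = 0) ->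
  exists2 A : 'M[F]_N, row_free A & forall i, S (row i A).
Proof.
move=> tot; suff H k : (k <= N)%N ->
    exists2 A : 'M[F]_(k, N), row_free A & forall i, S (row i A) by exact: H.
elim: k => [_|k IH ltk].
  exists 0; first by rewrite /row_free mxrank0.
  by case.
have [A Afree AS] := IH (ltnW ltk).
have [phi phi0 Aphi] : exists2 phi : 'cV[F]_N, phi != 0 & A *m phi = 0.
  have : kermx A^T != 0.
    by rewrite kermx_eq0 /row_free mxrank_tr (eqP Afree) ltn_eqF.
  case/rowV0Pn => w /sub_kermxP wA w0; exists w^T.
    by rewrite -trmx0 (inj_eq trmx_inj).
  by rewrite -[A]trmxK -trmx_mul wA trmx0.
have [s Ss sphi] : exists2 s, S s & s *m phi != 0.
  apply: contrapT => H; move/eqP: phi0; apply; apply: tot => s Ss.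
  by apply/eqP/negPn/negP => ?; apply: H; exists s.
have colfree : row_free (col_mx s A).
  rewrite -kermx_eq0; apply/rowV0P => w /sub_kermxP.
  rewrite -[w]hsubmxK mul_row_col => h.
  have w1 : lsubmx w = 0.
    have := congr1 (fun B => B *m phi) h; rewrite /= mulmxDl -!mulmxA.
    rewrite Aphi mulmx0 addr0 mul0mx.
    rewrite [lsubmx w]mx11_scalar mul_scalar_mx => /eqP.
    by rewrite scaler_eq0 (negPf sphi) orbF => /eqP ->; rewrite raddf0.
  move: h; rewrite w1 mul0mx add0r -[RHS](mul0mx _ A).
  move=> /(row_free_inj Afree) ->.
  by rewrite row_mx0.
have rowS (i : 'I_(1 + k)) : S (row i (col_mx s A)).
  case: (split_ordP i) => j ->; last by rewrite rowKd.
  by rewrite rowKu row_id.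
by exists (col_mx s A).
Qed.

(** * Comparing the internal dimensions *)

Lemma sum_row_mxMn (R : realType) (N d m : nat)
    (h : 'I_N -> ('rV[R]_d * 'rV[R]_m)%type) (p : 'I_N -> nat) :
  \sum_i row_mx (h i).1 (h i).2 *+ p i =
  row_mx (\sum_i h i *+ p i).1 (\sum_i h i *+ p i).2.
Proof.
pose J (s : ('rV[R]_d * 'rV[R]_m)%type) := row_mx s.1 s.2.
have JD : {morph J : x y / x + y} by move=> x y; rewrite /J add_row_mx.
have J0 : J 0 = 0 by rewrite /J row_mx0.
have JMn x k : J (x *+ k) = J x *+ k.
  by elim: k => [|k IH]; rewrite ?mulr0n // !mulrS JD IH.
by rewrite -/(J _) (big_morph J JD J0); apply: eq_bigr => i _; rewrite JMn.
Qed.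

(** The [d + m] independent lifts to [L] given by [lifts_total] and
    [spanning_row_free] project to points of R^d that also lift to [L'].  A
    relation between the lifts to [L'] would descend to R^d and come back to
    [L], so [combination_eq] leaves no room for [n < m]. *)
Lemma internal_dim_le (R : realType) (d m n : nat)
    (L : zmodClosed ('rV[R]_d * 'rV[R]_m)%type)
    (L' : zmodClosed ('rV[R]_d * 'rV[R]_n)%type) (r B : R) :
  discrete_subset [set` L] -> {in L &, injective fst} ->
  dense (snd @` [set` L]) -> discrete_subset [set` L'] ->
  (forall x, exists a y y', [/\ (a, y) \in L, (a, y') \in L', `|y| <= B
                              & `|x - a| <= r]) ->
  (m <= n)%N.
Proof.
move=> discL injL denseL discL' near_lift; rewrite leqNgt; apply/negP => lt_nm.
pose S : set ('rV[R]_d * 'rV[R]_m)%type :=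
  [set s | [/\ s \in L, `|s.2| <= B & exists y', (s.1, y') \in L']].
have tot (phi : 'cV[R]_(d + m)) :
    (forall s, ((fun s => row_mx s.1 s.2) @` S) s -> s *m phi = 0) -> phi = 0.
  rewrite -[phi]vsubmxK => Sphi.
  have [||||->->] := @lifts_total R d m L S r B (usubmx phi) (dsubmx phi) discL
    denseL; rewrite ?col_mx0 //.
  - by move=> s [].
  - by move=> s [].
  - move=> x; have [a [y [y' [ayL ay'L yB xa]]]] := near_lift x.
    by exists (a, y) => //; split=> //; exists y'.
  - by move=> s Ss; rewrite -mul_row_col Sphi ?mxE //; exists s.
have [A Afree AS] := spanning_row_free tot.
have /choice[h hP] : forall i, exists s, S s /\ row_mx s.1 s.2 = row i A.
  by move=> i; have [s Ss sA] := AS i; exists s.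
have /choice[y' y'P] : forall i, exists y', ((h i).1, y') \in L'.
  by move=> i; have [[]] := hP i.
have [|p [q [neq_pq eq_pq]]] :=
  @combination_eq R d n (d + m) L' (fun i => ((h i).1, y' i)) discL' y'P.
  by rewrite ltn_add2l.
have fst_sum k (z : 'I_(d + m) -> 'rV[R]_k) (c : 'I_(d + m) -> nat) :
    (\sum_i ((h i).1, z i) *+ c i).1 = \sum_i (h i).1 *+ c i.
  by rewrite raddf_sum; apply: eq_bigr => i _; rewrite raddfMn.
have hL c : \sum_i h i *+ c i \in L.
  by apply: rpred_sum => i _; apply: rpredMn; have [[]] := hP i.
have eqL : \sum_i h i *+ p i = \sum_i h i *+ q i.
  apply: injL => //.
  have := congr1 fst eq_pq; rewrite !fst_sum.
  by rewrite !raddf_sum /=; under eq_bigr do rewrite -raddfMn;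
     under [RHS]eq_bigr do rewrite -raddfMn.
have rowE c : (\row_i (c i)%:R : 'rV[R]__) *m A =
    row_mx (\sum_i h i *+ c i).1 (\sum_i h i *+ c i).2.
  rewrite -sum_row_mxMn mulmx_sum_row; apply: eq_bigr => i _.
  by rewrite mxE scaler_nat; have [_ ->] := hP i.
apply: neq_pq => i.
have /(row_free_inj Afree)/rowP/(_ i) :
    (\row_i (p i)%:R : 'rV[R]__) *m A = (\row_i (q i)%:R : 'rV[R]__) *m A.
  by rewrite !rowE eqL.
by rewrite !mxE => /eqP; rewrite eqr_nat => /eqP.
Qed.

Lemma precompact_norm_le (R : realType) (V : normedModType R) (A : set V) :
  precompact A -> exists2 C : R, 0 < C & forall a, A a -> `|a| <= C.
Proof.
rewrite precompactE => /compact_bounded/ex_strict_bound_gt0[C C0 AC].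
by exists C => // a Aa; apply/ltW/AC/subset_closure.
Qed.

Lemma euclid_ball_norm (R : realType) (d : nat) (x y : 'rV[R]_d) (r : R) :
  0 < r -> euclid_ball x r y -> `|x - y| < r.
Proof.
move=> r0 xy; apply: norm_lt_coord => // i; apply: le_lt_trans xy.
rewrite !mxE distrC -sqrtr_sqr ler_wsqrtr // (bigD1 i) //= lerDl.
by apply: sumr_ge0 => j _; exact: sqr_ge0.
Qed.

(** The points [a] form the set [D] of differences [l - g (f, f')], where [g]
    picks one point in each part of [Lambda].  Such a difference cancels both
    translations, so it lies in both projected lattices, and finiteness of [F]
    and [F'] bounds the displacement from [l]. *)
Lemma common_lifts (R : realType) (d m n : nat) (Lambda : set 'rV[R]_d)
    (L : zmodClosed ('rV[R]_d * 'rV[R]_m)%type)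
    (L' : zmodClosed ('rV[R]_d * 'rV[R]_n)%type)
    (W : set 'rV[R]_m) (W' : set 'rV[R]_n) (F F' : set 'rV[R]_d) :
  relatively_dense Lambda -> precompact W -> precompact W' ->
  finite_set F -> finite_set F' ->
  Lambda `<=` set_add (cut_project_set L W) F ->
  Lambda `<=` set_add (cut_project_set L' W') F' ->
  exists r B : R, forall x, exists a y y',
    [/\ (a, y) \in L, (a, y') \in L', `|y| <= B, `|y'| <= B & `|x - a| <= r].
Proof.
move=> [r r0 dense_r] /precompact_norm_le[B B0 WB].
move=> /precompact_norm_le[B' B'0 WB'].
move=> finF finF' sub sub'.
pose P (f : 'rV[R]_d * 'rV[R]_d) (l : 'rV[R]_d) :=
  cut_project_set L W (l - f.1) /\ cut_project_set L' W' (l - f.2).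
have /choice[g gP] : forall f, exists l0, forall l, P f l -> P f l0.
  move=> f; have [[l Pl]|nP] := pselect (exists l, P f l); first by exists l.
  by exists 0 => l Pl; case: nP; exists l.
have [C C0 gC] : exists2 C : R, 0 < C &
    forall a, (g @` (F `*` F')) a -> `|a| <= C.
  apply: precompact_norm_le; rewrite precompactE.
  have gfin : finite_set (g @` (F `*` F')).
    by apply: finite_image; exact: finite_setX.
  rewrite -(closure_id _).1; first exact: finite_compact.
  by apply: compact_closed => //; exact: finite_compact.
exists (r + C), (B *+ 2 + B' *+ 2) => x.
have [l [/(euclid_ball_norm r0) xl Ll]] := dense_r x.
have [a La [f Ff al]] := sub l Ll; have [a' La' [f' Ff' al']] := sub' l Ll.
have Pl : P (f, f') l by split=> /=; rewrite -?al ?addrK // al -al' addrK.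
have [[w0 Ww0 w0L] [w0' Ww0' w0L']] := gP _ _ Pl.
have [[w Ww wL] [w' Ww' wL']] := Pl.
exists (l - g (f, f')), (w - w0), (w' - w0'); split.
- have -> : (l - g (f, f'), w - w0) =
      (l - f, w) - (g (f, f') - f, w0) :> ('rV[R]_d * 'rV[R]_m)%type.
    by congr pair; rewrite /= opprB addrA subrK.
  exact: rpredB.
- have -> : (l - g (f, f'), w' - w0') =
      (l - f', w') - (g (f, f') - f', w0') :> ('rV[R]_d * 'rV[R]_n)%type.
    by congr pair; rewrite /= opprB addrA subrK.
  exact: rpredB.
- have := WB _ Ww; have := WB _ Ww0; have := ler_normB w w0; lra.
- have := WB' _ Ww'; have := WB' _ Ww0'; have := ler_normB w' w0'; lra.
- have gl : `|g (f, f')| <= C by apply: gC; exists (f, f').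
  rewrite opprB addrA [x + _]addrC -addrA addrC.
  apply: le_trans (ler_normD _ _) _; lra.
Qed.

Theorem corollary5p3 (R : realType) (d m n : nat) (hd : (1 <= d)%N)
    (Lambda : set 'rV[R]_d) (hLambda : meyer_set Lambda)
    (L : zmodClosed ('rV[R]_d * 'rV[R]_m)%type) (hL : cut_project_scheme L)
    (L' : zmodClosed ('rV[R]_d * 'rV[R]_n)%type) (hL' : cut_project_scheme L')
    (W : set 'rV[R]_m) (hW : precompact W) (hW0 : W° !=set0)
    (W' : set 'rV[R]_n) (hW' : precompact W') (hW'0 : (W')° !=set0)
    (F F' : set 'rV[R]_d) (hF : finite_set F) (hF' : finite_set F') :
  Lambda `<=` set_add (cut_project_set L W) F ->
  Lambda `<=` set_add (cut_project_set L' W') F' ->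
  m = n.
Proof.
move=> sub sub'.
have [[discL _] injL denseL] := hL; have [[discL' _] injL' denseL'] := hL'.
have [r [B near]] := common_lifts hLambda.1 hW hW' hF hF' sub sub'.
apply/eqP; rewrite eqn_leq; apply/andP; split.
- apply: (@internal_dim_le R d m n L L' r B) => // x.
  by have [a [y [y' [*]]]] := near x; exists a, y, y'.
- apply: (@internal_dim_le R d n m L' L r B) => // x.
  by have [a [y [y' [*]]]] := near x; exists a, y', y.
Qed.
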